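(* Let $a\in\mathbb{R}$, let $1<\nu<2$, and let $f:\mathbb{N}_a\to\mathbb{R}$ be such that $${}^{C}\Delta_a^{\nu}f(t)\ge -\frac{(t-a)^{(-\nu)}}{\Gamma(1-\nu)}f(a)-\frac{(t-a)^{(1-\nu)}}{\Gamma(2-\nu)}\Delta f(a)\quad\text{for each } t\in\mathbb{N}_{a+2-\nu}.$$ If $$f(a+3)\ge \frac{\nu}{k}f(a+2)+\frac{(k-\nu)\nu}{k(k+1)}f(a+1)+\frac{(k+1-\nu)(k-\nu)\nu}{(k+1)(k+2)k}f(a)\quad\text{for each } k\in\mathbb{N}_2,$$ then $\Delta f(t)\ge 0$ for all $t\in\mathbb{N}_{a+3}$.
   Context: For a real number $c$, $\mathbb{N}_c=\{c,c+1,c+2,\dots\}$. $\Delta f(t)=f(t+1)-f(t)$, $\Delta^m=\Delta(\Delta^{m-1})$, $\sigma(s)=s+1$. The falling function is $x^{(\beta)}=\Gamma(x+1)/\Gamma(x+1-\beta)$, with the convention that division at a pole yields zero. For $1<\nu<2$ (so $n=[\nu]+1=2$) the delta left Caputo fractional difference starting from $a$ is $${}^{C}\Delta_a^{\nu}f(t)=\frac{1}{\Gamma(2-\nu)}\sum_{s=a}^{t-(2-\nu)}(t-\sigma(s))^{(1-\nu)}\Delta^2 f(s),\qquad t\in\mathbb{N}_{a+2-\nu}.$$ *)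

(* Defs.v *)
From HB Require Import structures.
From mathcomp Require Import all_boot all_order all_algebra.
From mathcomp Require Import all_classical all_reals all_analysis.

Set Implicit Arguments.
Unset Strict Implicit.
Unset Printing Implicit Defensive.

Import Order.TTheory GRing.Theory Num.Theory.
Import numFieldNormedType.Exports.

Local Open Scope classical_set_scope.
Local Open Scope ring_scope.

Definition Nset (R : realType) (c : R) : set R := range (fun n : nat => c + n%:R).

Definition euler_integral (R : realType) (x : R) : R :=
  \int[@lebesgue_measure R]_(u in `]0, +oo[%classic) (u `^ (x - 1) * expR (- u)).

(* Euler's integral is extended to x <= 0 by iterating
   Gamma(x) = Gamma(x + 1) / x until the argument is positive.  At a pole
   x = 0, -1, -2, ... the product contains the factor 0, so Gamma x = 0 and
   dividing by Gamma x yields 0: this is the convention that division at a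
   pole yields zero. *)
Definition Gamma (R : realType) (x : R) : R :=
  let n := if 0 < x then 0%N else (Num.truncn (- x)).+1 in
  euler_integral (x + n%:R) / \prod_(i < n) (x + i%:R).

Definition falling (R : realType) (x b : R) : R :=
  Gamma (x + 1) / Gamma (x + 1 - b).

Definition delta (R : realType) (f : R -> R) : R -> R :=
  fun t => f (t + 1) - f t.

Definition sigma (R : realType) (s : R) : R := s + 1.

(* Delta left Caputo difference of order 1 < nu < 2 starting from a, meaningful
   for t in Nset (a + 2 - nu).  A function on Nset a is represented by a
   function on R: only its values on Nset a occur below. *)
Definition caputo (R : realType) (a nu : R) (f : R -> R) (t : R) : R :=
  (Gamma (2 - nu))^-1 *
  \sum_(s \in [set s | Nset a s /\ s <= t - (2 - nu)])
    falling (t - sigma s) (1 - nu) * iter 2 (@delta R) f s.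

(* Main.v *)
Require Import Defs.
From HB Require Import structures.
From mathcomp Require Import all_boot all_order all_algebra.
From mathcomp Require Import all_classical all_reals all_analysis.
From mathcomp Require Import ring lra measurable_realfun.
Import Order.TTheory GRing.Theory Num.Theory.
Import numFieldNormedType.Exports.
Local Open Scope classical_set_scope.
Local Open Scope ring_scope.

(* Put F j = f (a + j), let E j = F (j + 1) - F j, and let u_n be the coefficient
   of z^n in (1 - z)^(nu - 1).  Summation by parts turns the hypothesis on the
   Caputo difference into
     u_0 E_M + u_1 E_(M-1) + ... + u_M E_0 + u_(M+1) F 0 >= 0   for M >= 1.
   Here u_0 = 1 and u_n < 0 for n >= 1, so E_M >= 0 follows by strong induction
   on M >= 3: the terms with E_3, ..., E_(M-1) have the right sign, and the
   remaining ones, in F 0, ..., F 3, are handled by the initial condition with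
   k = M - 1, multiplied by the negative number u_(k-1).  Rewriting the falling
   functions as binomial coefficients needs Gamma (x + 1) = x Gamma x and
   Gamma x > 0 for x > 0. *)

(** * Euler's integral: functional equation, finiteness and positivity *)

Definition gamma_integrand {R : realType} (x u : R) : R := u `^ (x - 1) * expR (- u).

Lemma powR_expRN_cvgy {R : realType} (x : R) : 0 < x ->
  u `^ x * expR (- u) @[u --> +oo] --> (0 : R).
Proof.
move=> x0.
have h : ((2 * x) `^ x * expR (- (2^-1 * u)) @[u --> +oo] --> (0:R)).
  rewrite -[X in _ --> X](mulr0 ((2 * x) `^ x)).
  apply: cvgMr.
  apply: (@cvg_comp _ _ _ (fun u : R => 2^-1 * u) (fun u => expR (- u)) _ (pinfty_nbhs R)).
    exact: gt0_cvgMry.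
  exact: cvgr_expR.
apply: (squeeze_cvgr _ (cvg_cst 0) h).
near=> u.
have u0 : 0 < u by [].
rewrite mulr_ge0 ?powR_ge0 ?expR_ge0//=.
have -> : - u = - (2^-1 * u) - 2^-1 * u by lra.
rewrite expRD mulrA ler_wpM2r ?expR_ge0//.
rewrite -(ler_pM2r (expR_gt0 (2^-1 * u))) -mulrA -expRD addNr expR0 mulr1.
have -> : 2^-1 * u = (u / (2 * x)) * x by field; rewrite gt_eqF.
rewrite expRM -powRM ?expR_ge0//; last by lra.
apply: ge0_ler_powR; rewrite ?nnegrE ?mulr_ge0 ?expR_ge0//; try lra.
have := expR_ge1Dx (u / (2 * x)).
have e0 : 0 < 2 * x by lra.
move=> h1; rewrite mulrC -ler_pdivrMr//; lra.
Unshelve. all: end_near. Qed.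

Lemma is_derive_NexpRN {R : realType} (u : R) :
  is_derive u (1 : R) (fun v : R => - expR (- v)) (expR (- u)).
Proof. by apply: is_derive_eq; rewrite mulrN1 opprK. Qed.

Lemma integral_gamma_integrandD1 {R : realType} (x a b : R) : 0 < x -> 0 < a -> a < b ->
  (\int[lebesgue_measure]_(u in `[a, b]) (gamma_integrand (x + 1) u)%:E =
   (a `^ x * expR (- a) - b `^ x * expR (- b))%:E
   + x%:E * \int[lebesgue_measure]_(u in `[a, b]) (gamma_integrand x u)%:E)%E.
Proof.
move=> x0 a0 ab.
have cpow (y : R) : {within `[a, b], continuous (fun v : R => v `^ y)}.
  apply: derivable_within_continuous => u; rewrite in_itv/= => /andP[au _].
  by apply: derivable_powR; rewrite in_itv/= andbT; lra.
have LR (h dh : R -> R) : (forall u : R, 0 < u -> is_derive u (1:R) h (dh u)) ->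
    derivable_oo_LRcontinuous h a b.
  move=> hd.
  have hc (u : R) : 0 < u -> {for u, continuous h}.
    move=> /hd ?; apply: differentiable_continuous.
    exact/derivable1_diffP.
  split.
  - by move=> u; rewrite in_itv/= => /andP[au _]; have := hd u (lt_trans a0 au); case.
  - by apply: cvg_at_right_filter; apply: hc.
  - by apply: cvg_at_left_filter; apply: hc; lra.
have dE (h dh : R -> R) : (forall u : R, 0 < u -> is_derive u (1:R) h (dh u)) ->
    {in `]a, b[, (h^`())%classic =1 dh}.
  move=> hd u; rewrite in_itv/= => /andP[au _]; rewrite derive1E.
  by have [_ ->] := hd u (lt_trans a0 au).
have pd (u : R) : 0 < u -> is_derive u (1:R) (fun v : R => v `^ x) (x * u `^ (x - 1)).
  by move=> u0; exact: is_derive1_powR.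
under eq_integral do rewrite /gamma_integrand addrK.
rewrite (@integration_by_parts _ (fun v : R => v `^ x) (fun u => - expR (- u))
   (fun u => x * u `^ (x - 1)) (fun u => expR (- u)))//; first last.
- by apply: dE => u _; exact: is_derive_NexpRN.
- by apply: (LR _ _ (fun u _ => is_derive_NexpRN u)).
- apply: continuous_subspaceT => u.
  by apply: continuous_comp; [exact: opp_continuous|exact: continuous_expR].
- exact: dE.
- exact: LR.
- apply: derivable_within_continuous => u; rewrite in_itv/= => /andP[au _].
  apply: derivableM; first exact: derivable_cst.
  by apply: derivable_powR; rewrite in_itv/= andbT; lra.
congr (_ + _)%E; first by rewrite !mulrN opprK addrC.
rewrite -ge0_integralZl_EFin//; last 3 first.
- by move=> u _; rewrite lee_fin mulr_ge0 ?powR_ge0 ?expR_ge0.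
- apply/measurable_EFinP/measurable_funM.
    apply: measurable_funTS; exact: measurable_powR.
  by apply: measurable_funTS; apply: measurableT_comp.
- exact: ltW.
rewrite -[RHS]oppeK -integral_ge0N; last first.
  by move=> u _; rewrite lee_fin !mulr_ge0 ?powR_ge0 ?expR_ge0 ?(ltW x0).
by congr (- _)%E; apply: eq_integral => u _; rewrite /gamma_integrand -EFinM mulrN mulrA.
Qed.

Lemma gamma_integrand_ge0 {R : realType} (x u : R) : 0 <= gamma_integrand x u.
Proof. by rewrite mulr_ge0 ?powR_ge0 ?expR_ge0. Qed.

Lemma measurable_gamma_integrand {R : realType} (x : R) (D : set R) :
  measurable_fun D (fun u => (gamma_integrand x u)%:E).
Proof.
apply: measurable_funTS; apply/measurable_EFinP/measurable_funM.
  exact: measurable_powR.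
by apply: measurableT_comp.
Qed.

(* The value in [\bar R] keeps track of finiteness, which [fine] would lose. *)
Definition extended_euler_integral {R : realType} (x : R) : \bar R :=
  (\int[lebesgue_measure]_(u in `]0%R, +oo[) (gamma_integrand x u)%:E)%E.

Lemma itvoy_bigcup_itvcc {R : realType} :
  `]0, +oo[%classic = \bigcup_n `[n.+1%:R^-1, n.+1%:R]%classic :> set R.
Proof.
apply/seteqP; split=> [u|u [n _]] /=; rewrite !in_itv/= ?andbT; last first.
  by move=> /andP[+ _]; apply: lt_le_trans; rewrite invr_gt0.
move=> u0.
(* With this index both [u] and its inverse lie below [n + 1]. *)
exists (maxn (Num.truncn u) (Num.truncn u^-1)) => //=.
rewrite in_itv/=; apply/andP; split.
  rewrite -[leRHS]invrK lef_pV2 ?posrE ?invr_gt0//.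
  apply: (le_trans (ltW (truncnS_gt _))).
  by rewrite ler_nat ltnS leq_maxr.
apply: (le_trans (ltW (truncnS_gt _))).
by rewrite ler_nat ltnS leq_maxl.
Qed.

(* Exhausting ]0, +oo[ by [1/(n+1), n+1] avoids the singularity at 0. *)
Lemma cvg_extended_euler_integral {R : realType} (x : R) :
  (\int[lebesgue_measure]_(u in `[n.+1%:R^-1%R, n.+1%:R%R]) (gamma_integrand x u)%:E
     @[n --> \oo] --> extended_euler_integral x)%E.
Proof.
rewrite /extended_euler_integral itvoy_bigcup_itvcc.
apply: ge0_nondecreasing_set_cvg_integral => //=.
- move=> n m nm; rewrite subsetEset; apply: subset_itv; rewrite bnd_simp.
    by rewrite lef_pV2 ?posrE// ler_nat.
  by rewrite ler_nat.
- by move=> n; exact: measurable_gamma_integrand.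
- by move=> n u _; rewrite lee_fin gamma_integrand_ge0.
Qed.

(** Limit of the integration by parts along the exhausting intervals; the boundary terms vanish at
    both ends. Stated in the extended reals, it can serve to prove finiteness. *)
Lemma extended_euler_integralD1 {R : realType} (x : R) : 0 < x ->
  extended_euler_integral (x + 1) = (x%:E * extended_euler_integral x)%E.
Proof.
move=> x0.
pose b (u : R) := u `^ x * expR (- u).
have h : ((b n.+1%:R^-1 - b n.+1%:R)%:E + x%:E *
    \int[lebesgue_measure]_(u in `[n.+1%:R^-1%R, n.+1%:R%R]) (gamma_integrand x u)%:E
    @[n --> \oo] --> (0%:E + x%:E * extended_euler_integral x))%E.
  apply: cvgeD; first exact: fin_num_adde_defr.
    apply/cvg_EFin; first exact: nearW.
    rewrite -[X in _ --> X]subr0.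
    apply: cvgB.
      have h : n.+1%:R^-1 `^ x @[n --> \oo] --> (0 : R).
        have h0 := powR_cvg0 x0.
        apply: ((cvg_at_rightP _ _ _).1 h0); split => //.
        exact: cvg_harmonic.
      (* Near 0 the exponential factor is at most 1, so the power alone dominates. *)
      apply: (squeeze_cvgr _ (cvg_cst 0) h); near=> n.
      by rewrite mulr_ge0 ?powR_ge0 ?expR_ge0//= ler_piMr ?powR_ge0// expR_le1 oppr_le0 invr_ge0.
    have : (n.+1%:R : R) @[n --> \oo] --> +oo.
      by rewrite (cvg_shiftS (fun n => n%:R : R)); exact: cvgr_idn.
    move=> hc; exact: (cvg_comp _ b hc (powR_expRN_cvgy x x0)).
  apply: cvgeZl => //; exact: cvg_extended_euler_integral.
rewrite add0e in h.
apply: cvg_unique (@cvg_extended_euler_integral _ (x + 1)) _ => //.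
apply: cvg_trans h; apply: near_eq_cvg; near=> n.
(* For [n = 0] the interval is the single point 1, whereas integration by parts asks for [a < b]. *)
have n0 : (0 < n)%N by near: n; exists 1%N.
have n1 : 1 < n.+1%:R :> R by rewrite ltr1n.
have n2 : 0 < n.+1%:R^-1 :> R by rewrite invr_gt0 ltr0n.
have n3 : n.+1%:R^-1 < n.+1%:R :> R.
  by apply: (lt_trans _ n1); rewrite invf_lt1// ltr0n.
by symmetry; exact: (integral_gamma_integrandD1 _ _ _ x0 n2 n3).
Unshelve. all: end_near. Qed.

Lemma extended_euler_integral1 {R : realType} :
  extended_euler_integral (1 : R) = 1%E.
Proof.
rewrite /extended_euler_integral integral_itv_obnd_cbnd; last first.
  exact: measurable_gamma_integrand.
rewrite (@ge0_continuous_FTC2y _ _ (fun u : R => - expR (- u)) _ 0)//.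
- by rewrite oppr0 expR0 EFinN oppeK add0e.
- by move=> u _; exact: gamma_integrand_ge0.
- rewrite /gamma_integrand subrr.
  apply: continuous_subspaceT => u.
  under eq_fun do rewrite powRr0 mul1r.
  by apply: continuous_comp; [exact: opp_continuous|exact: continuous_expR].
- by rewrite -oppr0; apply: cvgN; exact: cvgr_expR.
- apply: cvgN; apply: cvg_at_right_filter.
  by apply: continuous_comp; [exact: opp_continuous|exact: continuous_expR].
- move=> u _; rewrite /gamma_integrand subrr powRr0 mul1r derive1E.
  by have [_ ->] := is_derive_NexpRN u.
Qed.

Lemma extended_euler_integral_ge0 {R : realType} (x : R) :
  (0 <= extended_euler_integral x)%E.
Proof. by apply: integral_ge0 => u _; rewrite lee_fin gamma_integrand_ge0. Qed.

Lemma extended_euler_integral_fin_num {R : realType} (x : R) : 0 < x ->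
  extended_euler_integral x \is a fin_num.
Proof.
have base (y : R) : 0 < y <= 1 -> extended_euler_integral y \is a fin_num.
  move=> /andP[y0 y1].
  have : (extended_euler_integral (y + 1) < +oo)%E.
    apply: (@le_lt_trans _ _ (extended_euler_integral (1 : R) + extended_euler_integral (1 + 1 : R)))%E.
      rewrite /extended_euler_integral -ge0_integralD//; last 4 first.
      - by move=> u _; rewrite lee_fin gamma_integrand_ge0.
      - exact: measurable_gamma_integrand.
      - by move=> u _; rewrite lee_fin gamma_integrand_ge0.
      - exact: measurable_gamma_integrand.
      apply: ge0_le_integral => //.
      - by move=> u _; rewrite lee_fin gamma_integrand_ge0.
      - exact: measurable_gamma_integrand.
      - by apply: emeasurable_funD; exact: measurable_gamma_integrand.
      move=> u /=; rewrite in_itv/= andbT => u0.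
      rewrite -EFinD lee_fin /gamma_integrand !addrK subrr powRr0 -mulrDl powRr1 ?(ltW u0)//.
      rewrite ler_pM2r ?expR_gt0//.
      have [u1|u1] := leP u 1.
        rewrite (@le_trans _ _ 1)//; last by rewrite lerDl ltW.
        by rewrite -[leRHS](powRr0 u) ger_powR// ?u0// ltW.
      rewrite (@le_trans _ _ u)//; last by rewrite lerDr.
      by rewrite ler1_powR// ltW.
    by rewrite extended_euler_integralD1// extended_euler_integral1 mule1 -EFinD ltry.
  rewrite extended_euler_integralD1//.
  case: extended_euler_integral (extended_euler_integral_ge0 y) => // _.
  by rewrite gt0_muley// lte_fin.
have ind (n : nat) (y : R) : 0 < y -> y <= n.+1%:R ->
    extended_euler_integral y \is a fin_num.
  elim: n y => [|n IH] y y0 yn; first by apply: base; rewrite y0.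
  have [y1|y1] := leP y 1; first by apply: base; rewrite y0.
  rewrite -(subrK 1 y) extended_euler_integralD1 ?subr_gt0// fin_numM// IH ?subr_gt0//.
  by rewrite lerBlDr natr1.
by move=> x0; apply: (ind (Num.truncn x)) => //; exact/ltW/truncnS_gt.
Qed.

Lemma extended_euler_integral_gt0 {R : realType} (x : R) : 0 < x ->
  (0 < extended_euler_integral x)%E.
Proof.
move=> x0.
pose c : R := 2^-1 * expR (- 2).
have c0 : 0 < c by rewrite mulr_gt0 ?expR_gt0 ?invr_gt0.
apply: (@lt_le_trans _ _ (\int[lebesgue_measure]_(u in `[1%R, 2%R]) (cst c%:E u)))%E.
  rewrite integral_cst//= lebesgue_measure_itv/= lte_fin ltr1n/= -EFinB -EFinM lte_fin.
  by rewrite mulr_gt0//; lra.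
apply: (@le_trans _ _ (\int[lebesgue_measure]_(u in `[1%R, 2%R]) (gamma_integrand x u)%:E))%E.
  apply: ge0_le_integral => //.
  - by move=> u _; rewrite lee_fin ltW.
  - exact: measurable_gamma_integrand.
  move=> u /=; rewrite in_itv/= lee_fin => /andP[u1 u2].
  rewrite /c /gamma_integrand ler_pM ?expR_ge0 ?invr_ge0//; last by rewrite ler_expR; lra.
  apply: (@le_trans _ _ (u `^ (-1))); last by apply: ler_powR => //; lra.
  by rewrite powR_inv1 ?lef_pV2 ?posrE//; lra.
apply: ge0_subset_integral => //.
- exact: measurable_gamma_integrand.
- by move=> u _; rewrite lee_fin gamma_integrand_ge0.
- by move=> u /=; rewrite !in_itv/= andbT => /andP[+ _]; apply: lt_le_trans.
Qed.

(** * The Gamma function *)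

Lemma Gamma_pos {R : realType} (x : R) : 0 < x ->
  Gamma x = fine (extended_euler_integral x).
Proof. by move=> x0; rewrite /Gamma x0 big_ord0 divr1 addr0. Qed.

Lemma Gamma_gt0 {R : realType} (x : R) : 0 < x -> 0 < Gamma x.
Proof.
move=> x0; rewrite Gamma_pos// fine_gt0//.
by rewrite extended_euler_integral_gt0// ltey_eq extended_euler_integral_fin_num.
Qed.

Lemma GammaD1 {R : realType} (x : R) : 0 < x -> Gamma (x + 1) = x * Gamma x.
Proof.
move=> x0; rewrite !Gamma_pos ?addr_gt0// extended_euler_integralD1//.
by rewrite fineM// extended_euler_integral_fin_num.
Qed.

Lemma Gamma1 {R : realType} : Gamma (1 : R) = 1.
Proof. by rewrite Gamma_pos// extended_euler_integral1. Qed.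

(** Here [Num.truncn (- x)] is 0, so the extension takes exactly one step. This is the case of
    [Gamma (1 - nu)]. *)
Lemma Gamma_Nitv {R : realType} (x : R) : -1 < x < 0 ->
  Gamma x = Gamma (x + 1) / x.
Proof.
move=> /andP[x1 x0]; have x10 : 0 < x + 1 by lra.
rewrite (Gamma_pos (x + 1))// /Gamma ltNge (ltW x0)/=.
have -> : Num.truncn (- x) = 0%N by apply/truncn0Pn; rewrite -ltNge; lra.
by rewrite big_ord1 addr0.
Qed.

(** * Binomial coefficients and their link with Gamma *)

(* The coefficient of z^n in (1 - z)^(-r). *)
Definition binom_coef {R : realType} (r : R) (n : nat) : R :=
  \prod_(i < n) ((r + i%:R) / i.+1%:R).

Lemma binom_coef0 {R : realType} (r : R) : binom_coef r 0 = 1.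
Proof. exact: big_ord0. Qed.

Lemma binom_coefS {R : realType} (r : R) n :
  binom_coef r n.+1 = binom_coef r n * ((r + n%:R) / n.+1%:R).
Proof. exact: big_ord_recr. Qed.

(** Coefficientwise, the derivative of [(1 - z)^(-r)] is [r (1 - z)^(-r-1)]. *)
Lemma binom_coefD1 {R : realType} (r : R) n :
  binom_coef r n.+1 * n.+1%:R = r * binom_coef (r + 1) n.
Proof.
elim: n => [|n IH].
  by rewrite binom_coefS !binom_coef0 addr0; field.
rewrite [binom_coef (r + 1) _]binom_coefS mulrA -IH [in LHS]binom_coefS.
rewrite -[n.+2%:R]natr1 -[n.+1%:R]natr1; field.
by rewrite !natr1 !pnatr_eq0.
Qed.

(** Coefficientwise, [(1 - z)^(-r) = (1 - z) (1 - z)^(-r-1)]. *)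
Lemma binom_coefB {R : realType} (r : R) n :
  binom_coef r n.+1 = binom_coef (r + 1) n.+1 - binom_coef (r + 1) n.
Proof.
have n1 : n.+1%:R != 0 :> R by rewrite pnatr_eq0.
apply: (mulIf n1); rewrite binom_coefD1 binom_coefS mulrBl.
by rewrite -natr1 in n1 *; field.
Qed.

(** The factor with [i = 0] has the sign of [r]; all later ones are positive because [r + 1 > 0]. *)
Lemma binom_coef_lt0 {R : realType} (r : R) n : -1 < r < 0 ->
  binom_coef r n.+1 < 0.
Proof.
move=> /andP[r1 r0]; elim: n => [|n IH].
  by rewrite binom_coefS binom_coef0 addr0 mul1r divr1.
rewrite binom_coefS nmulr_rlt0// divr_gt0//.
have := ler0n R n; rewrite -natr1; lra.
Qed.

(** Raising [n] by one multiplies the quotient by [(r + n) / (n + 1)], the new factor of the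
    coefficient. *)
Lemma Gamma_ratio {R : realType} (r : R) n : 0 < r ->
  Gamma (r + n%:R) / Gamma (n%:R + 1) = Gamma r * binom_coef r n.
Proof.
move=> r0; elim: n => [|n IH].
  by rewrite addr0 add0r Gamma1 divr1 binom_coef0 mulr1.
rewrite binom_coefS mulrA -IH -[n.+1%:R]natr1 addrA.
rewrite GammaD1 ?ltr_pwDl// [Gamma (_ + 1 + 1)]GammaD1 ?ltr_wpDl//.
field.
by rewrite natr1 pnatr_eq0/= gt_eqF// Gamma_gt0.
Qed.

(** * From the Caputo difference to a convolution of first differences *)

(** Abel summation: the difference moves from [E] to the weights, turning [w] into [u] and leaving
    the boundary term [w m.+1 * E 0]. *)
Lemma sum_by_parts {R : realType} (w u E : nat -> R) m : u 0%N = w 0%N ->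
  (forall n, u n.+1 = w n.+1 - w n) ->
  \sum_(j < m.+1) w (m - j)%N * (E j.+1 - E j) + w m.+1 * E 0%N =
  \sum_(j < m.+2) u (m.+1 - j)%N * E j.
Proof.
move=> u0 uS.
under eq_bigr do rewrite mulrBr.
rewrite sumrB addrAC addrC [_ + w m.+1 * _]addrC.
have -> : w m.+1 * E 0%N + \sum_(j < m.+1) w (m - j)%N * E j.+1 =
    \sum_(j < m.+2) w (m.+1 - j)%N * E j.
  by rewrite [RHS]big_ord_recl.
rewrite !(big_ord_recr m.+1)/= subnn u0 addrA; congr (_ + _).
rewrite addrC -sumrB; apply: eq_bigr => j _.
by rewrite subSn -1?ltnS// uS mulrBl.
Qed.

(** The sum runs over [s = a + j] with [j <= m], where the kernel is [Gamma (2 - nu + (m - j)) /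
    Gamma (m - j + 1)]; [Gamma_ratio] cancels the prefactor. *)
Lemma caputoE {R : realType} (a nu : R) (f : R -> R) m : nu < 2 ->
  caputo a nu f (a + 2 - nu + m%:R) =
  \sum_(j < m.+1) binom_coef (2 - nu) (m - j) *
    (delta f (a + j.+1%:R) - delta f (a + j%:R)).
Proof.
move=> nu2; rewrite /caputo.
have -> : [set s | Nset a s /\ s <= a + 2 - nu + m%:R - (2 - nu)] =
    (fun n : nat => a + n%:R) @` `I_m.+1.
  apply/seteqP; split=> [s [[n _ <-]]|s [n /= nm <-]].
    move=> h; exists n => //=; rewrite ltnS -(ler_nat R); lra.
  split; first by exists n.
  by move: nm; rewrite ltnS -(ler_nat R); lra.
rewrite fsbig_image; last first.
  by move=> i j _ _ /addrI /eqP; rewrite eqr_nat => /eqP.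
rewrite -fsbig_ord mulr_sumr; apply: eq_bigr => j _.
rewrite mulrA; congr (_ * _).
  have jm : (j <= m)%N by rewrite -ltnS.
  rewrite /falling /sigma.
  have -> : a + 2 - nu + m%:R - (a + j%:R + 1) + 1 = 2 - nu + (m - j)%:R.
    by rewrite natrB//; lra.
  have -> : 2 - nu + (m - j)%:R - (1 - nu) = (m - j)%:R + 1 by lra.
  rewrite Gamma_ratio ?subr_gt0// mulKf// gt_eqF// Gamma_gt0// subr_gt0//.
by rewrite /= /delta -[j.+1%:R]natr1 !addrA.
Qed.

(** The [delta f a] term of the bound is exactly the boundary term of the summation by parts, and
    the [f a] term continues the convolution by one more coefficient. *)
Lemma caputo_lower_bound_sum {R : realType} (a nu : R) (f : R -> R) m : 1 < nu -> nu < 2 ->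
  caputo a nu f (a + 2 - nu + m%:R) >=
    - (falling (a + 2 - nu + m%:R - a) (- nu) / Gamma (1 - nu)) * f a
    - falling (a + 2 - nu + m%:R - a) (1 - nu) / Gamma (2 - nu) * delta f a ->
  0 <= \sum_(j < m.+2) binom_coef (1 - nu) (m.+1 - j) * delta f (a + j%:R)
    + binom_coef (1 - nu) m.+2 * f a.
Proof.
move=> nu1 nu2.
have G0 : 0 < Gamma (2 - nu) by rewrite Gamma_gt0 ?subr_gt0.
have e1 : 1 - nu + 1 = 2 - nu by lra.
rewrite caputoE//.
have -> : falling (a + 2 - nu + m%:R - a) (1 - nu) / Gamma (2 - nu) =
    binom_coef (2 - nu) m.+1.
  rewrite /falling.
  have -> : a + 2 - nu + m%:R - a + 1 = 2 - nu + m.+1%:R by rewrite -natr1; lra.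
  have -> : 2 - nu + m.+1%:R - (1 - nu) = m.+1%:R + 1 by lra.
  by rewrite Gamma_ratio ?subr_gt0// mulrAC divff ?mul1r// gt_eqF.
have -> : falling (a + 2 - nu + m%:R - a) (- nu) / Gamma (1 - nu) =
    binom_coef (1 - nu) m.+2.
  rewrite /falling.
  have -> : a + 2 - nu + m%:R - a + 1 = 2 - nu + m.+1%:R by rewrite -natr1; lra.
  have -> : 2 - nu + m.+1%:R - - nu = m.+1%:R + 1 + 1 by lra.
  have m2 : m.+2%:R != 0 :> R by rewrite pnatr_eq0.
  apply: (mulIf m2).
  (* [Gamma (1 - nu) = Gamma (2 - nu) / (1 - nu)] supplies the factor [1 - nu] of [binom_coefD1],
     and [Gamma (m + 3) = (m + 2) * Gamma (m + 2)] its factor [m + 2]. *)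
  rewrite binom_coefD1 e1 [Gamma (1 - nu)]Gamma_Nitv ?e1; last lra.
  rewrite GammaD1 ?ltr_wpDl// -natr1.
  have := Gamma_ratio (2 - nu) m.+1; rewrite subr_gt0 => /(_ nu2).
  have : Gamma (m.+1%:R + 1 : R) != 0 by rewrite gt_eqF// Gamma_gt0 ?ltr_wpDl.
  move: (Gamma (_ + 1)) (Gamma (_ + m.+1%:R)) => g h g0.
  move=> /(canRL (divfK g0)) ->.
  rewrite -natr1 in m2 *.
  field; apply/and4P; split=> //.
  - by rewrite subr_eq0 lt_eqF.
  - by rewrite gt_eqF.
rewrite -(sum_by_parts (binom_coef (2 - nu)) (binom_coef (1 - nu)) (fun j => delta f (a + j%:R))).
- by rewrite addr0; lra.
- by rewrite !binom_coef0.
- by move=> n; rewrite binom_coefB e1.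
Qed.

(** * Sign analysis and strong induction *)

(** With [u] the coefficient of index [k - 1], these are the last four terms of the convolution;
    they collapse to [u] times the slack of the initial condition. *)
Lemma initial_condition_sum_le0 {R : realType} (nu u k F0 F1 F2 F3 : R) :
  0 < k -> u <= 0 ->
  F3 >= nu / k * F2 + (k - nu) * nu / (k * (k + 1)) * F1
    + (k + 1 - nu) * (k - nu) * nu / ((k + 1) * (k + 2) * k) * F0 ->
  u * (F3 - F2) + u * ((k - nu) / k) * (F2 - F1)
    + u * ((k - nu) / k) * ((k + 1 - nu) / (k + 1)) * (F1 - F0)
    + u * ((k - nu) / k) * ((k + 1 - nu) / (k + 1)) * ((k + 2 - nu) / (k + 2)) * F0
  <= 0.
Proof.
move=> k0 u0; set rhs := (X in X <= F3) => h.
rewrite [leLHS](_ : _ = u * (F3 - rhs)); last by rewrite /rhs; field; lra.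
by rewrite mulr_le0_ge0// subr_ge0.
Qed.

Lemma increment_ge0 {R : realType} (nu : R) (F : nat -> R) : 1 < nu -> nu < 2 ->
  (forall m, 0 <= \sum_(j < m.+2) binom_coef (1 - nu) (m.+1 - j) * (F j.+1 - F j)
    + binom_coef (1 - nu) m.+2 * F 0%N) ->
  (forall k : nat, F 3%N >= nu / k.+2%:R * F 2%N
    + (k.+2%:R - nu) * nu / (k.+2%:R * (k.+2%:R + 1)) * F 1%N
    + (k.+2%:R + 1 - nu) * (k.+2%:R - nu) * nu /
        ((k.+2%:R + 1) * (k.+2%:R + 2) * k.+2%:R) * F 0%N) ->
  forall n, (3 <= n)%N -> 0 <= F n.+1 - F n.
Proof.
move=> nu1 nu2 hF init; elim/ltn_ind => -[|[|[|k]]]// IH _.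
have nuI : -1 < 1 - nu < 0 by lra.
have u1 : binom_coef (1 - nu) k.+1 <= 0 by rewrite ltW ?binom_coef_lt0.
have uS j : binom_coef (1 - nu) j.+2 =
    binom_coef (1 - nu) j.+1 * ((j.+2%:R - nu) / j.+2%:R).
  by rewrite binom_coefS -[j.+2%:R]natr1; congr (_ * (_ / _)); lra.
(* The current index is [n = k + 3]; the summand split off is [F n.+1 - F n], with coefficient 1. *)
have := hF k.+2; rewrite big_ord_recr/= subnn binom_coef0 mul1r.
rewrite -(big_mkord xpredT (fun j => binom_coef (1 - nu) (k.+3 - j) * (F j.+1 - F j))).
rewrite (@big_cat_nat _ _ _ 3)//=.
have tail : \sum_(3 <= j < k.+3) binom_coef (1 - nu) (k.+3 - j) * (F j.+1 - F j) <= 0.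
  rewrite big_nat_cond sumr_le0// => j; rewrite andbT => /andP[j3 jk].
  (* Since [j < k + 3], the coefficient has positive index, hence is negative. *)
  rewrite mulr_le0_ge0 ?IH//; move: jk; rewrite -subn_gt0.
  by case: (k.+3 - j)%N => // i _; rewrite ltW ?binom_coef_lt0.
move: tail; set tail := \sum_(3 <= j < _) _ => tail0.
have K0 : 0 < k.+2%:R :> R by rewrite ltr0n.
(* [init k] is the initial condition at parameter [k + 2 = n - 1]; reading [uS] backwards recovers
   the coefficients of index [k + 2], [k + 3] and [k + 4]. *)
have := initial_condition_sum_le0 nu _ _ _ _ _ _ K0 u1 (init k).
rewrite -natrD addn2 natr1 -!uS !big_nat_recr//= big_geq// add0r !subSS !subn0.
lra.
Qed.

Theorem theorem3p4 (R : realType) (a nu : R) (hnu1 : 1 < nu) (hnu2 : nu < 2)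
    (f : R -> R)
    (hcaputo : forall t : R, Nset (a + 2 - nu) t ->
       caputo a nu f t >=
         - (falling (t - a) (- nu) / Gamma (1 - nu)) * f a
         - falling (t - a) (1 - nu) / Gamma (2 - nu) * delta f a)
    (hinit : forall k : R, Nset 2 k ->
       f (a + 3) >=
         nu / k * f (a + 2)
         + (k - nu) * nu / (k * (k + 1)) * f (a + 1)
         + (k + 1 - nu) * (k - nu) * nu / ((k + 1) * (k + 2) * k) * f a) :
  forall t : R, Nset (a + 3) t -> 0 <= delta f t.
Proof.
have dE n : delta f (a + n%:R) = f (a + n.+1%:R) - f (a + n%:R).
  by rewrite /delta -addrA natr1.
move=> t [n _ <-]; rewrite -addrA -natrD dE.
apply: (increment_ge0 nu (fun n => f (a + n%:R))) => // [m|k].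
  have := caputo_lower_bound_sum _ _ _ m hnu1 hnu2 (hcaputo _ (ex_intro2 _ _ m I erefl)).
  by under eq_bigr do rewrite dE; rewrite addr0.
rewrite addr0; apply: hinit; exists k => //.
by rewrite -natrD.
Qed.
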